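(* Let $r\in\mathbb{N}$, $n\in\mathbb{N}_0$, $x,y\in\mathbb{C}$, and $\lambda\in\mathbb{C}$ with $|\lambda|<1$. Then $$\Phi^{B,r}_{M,\lambda}(-n,x+_My)=\sum_{k=0}^{n}\binom{n}{k}_M\Phi^{B,r}_{M,\lambda}(-k,x)\,y^{n-k}$$ and $$\Phi^{E,r}_{M,\lambda}(-n,x+_My)=\sum_{k=0}^{n}\binom{n}{k}_M\Phi^{E,r}_{M,\lambda}(-k,x)\,y^{n-k}.$$
   Context: $\mathbb{N}=\{1,2,\ldots\}$, $\mathbb{N}_0=\{0,1,2,\ldots\}$. For $n\ge 0$, $M_n=2^n-1$. The M-factorial is $M_0!=1$ and $M_n!=M_nM_{n-1}\cdots M_1$ for $n\geq 1$. The M-binomial coefficient is $\binom{n}{k}_M=\frac{M_n!}{M_k!M_{n-k}!}$ for $0\le k\le n$. The M-exponential is $e_M^{xt}=\sum_{n=0}^{\infty}\frac{x^nt^n}{M_n!}$, and $e_M^t$ denotes the case $x=1$. For $m\in\mathbb{N}_0$ the Mersenne translation polynomials $P_{n,M}(x;m)$ are defined by $e_M^{xt}\left(e_M^t\right)^m=\sum_{n=0}^{\infty}P_{n,M}(x;m)\frac{t^n}{M_n!}$, where $(e_M^t)^m$ is the ordinary $m$-fold product. For $r\in\mathbb{N}$, $n\in\mathbb{N}_0$, $x\in\mathbb{C}$ and $|\lambda|<1$, the Bernoulli-type and Euler-type Mersenne-Lerch interpolation values of order $r$ at $-n$ are the (convergent) series $\Phi^{B,r}_{M,\lambda}(-n,x)=\sum_{m=0}^{\infty}\binom{m+r-1}{m}\lambda^mP_{n,M}(x;m)$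 and $\Phi^{E,r}_{M,\lambda}(-n,x)=\sum_{m=0}^{\infty}(-1)^m\binom{m+r-1}{m}\lambda^mP_{n,M}(x;m)$, where $\binom{m+r-1}{m}$ is the ordinary binomial coefficient and $\lambda^0=1$; these are polynomials in $x$. The M-binomial addition $x+_My$ is a symbolic (umbral) expression determined by $(x+_My)^n=\sum_{k=0}^{n}\binom{n}{k}_Mx^ky^{n-k}$ for $n\ge 0$; for a polynomial $f(x)=\sum_ka_kx^k$, $f(x+_My)$ means $\sum_ka_k(x+_My)^k$ with each $(x+_My)^k$ given by this formula. In particular $e_M^{(x+_My)t}=e_M^{xt}e_M^{yt}$. *)

(* Defs.v *)
From HB Require Import structures.
From mathcomp Require Import all_boot all_order all_algebra.
From mathcomp Require Import all_classical all_reals.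
From mathcomp Require Import topology normedtype sequences.
From mathcomp Require Import complex.

Set Implicit Arguments.
Unset Strict Implicit.
Unset Printing Implicit Defensive.

Import Order.TTheory GRing.Theory Num.Theory.
Import numFieldNormedType.Exports.

Local Open Scope ring_scope.
Local Open Scope classical_set_scope.
Local Open Scope complex_scope.

Definition mersenne (n : nat) : nat := 2 ^ n - 1.

Definition Mfact (n : nat) : nat := \prod_(1 <= i < n.+1) mersenne i.

(* Only meaningful for k <= n. *)
Definition Mbinom (K : fieldType) (n k : nat) : K :=
  (Mfact n)%:R / ((Mfact k)%:R * (Mfact (n - k))%:R).

(* A power series in t is the sequence of its coefficients. The identity      *)
(* defining P_{n,M}(x;m) is read coefficientwise in t, so e_M^{xt} is used as *)
(* a power series in t and not as a function of t.                            *)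
Definition fps (K : fieldType) := nat -> K.

Definition fps1 (K : fieldType) : fps K := fun n => (n == 0)%:R.

Definition fps_mul (K : fieldType) (a b : fps K) : fps K :=
  fun n => \sum_(k < n.+1) a k * b (n - k)%N.

Definition fps_exp (K : fieldType) (a : fps K) (m : nat) : fps K :=
  iter m (fps_mul a) (@fps1 K).

Definition Mexp (K : fieldType) (x : K) : fps K :=
  fun n => x ^+ n / (Mfact n)%:R.

(* P_{n,M}(x;m) *)
Definition Mtrans (K : fieldType) (n : nat) (x : K) (m : nat) : K :=
  (Mfact n)%:R * fps_mul (Mexp x) (fps_exp (Mexp 1) m) n.

(* Phi^{B,r}_{M,lambda}(-n,x) and Phi^{E,r}_{M,lambda}(-n,x). The regular     *)
(* module R[i]^o carries the usual normed topology of the complex numbers.    *)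
Definition PhiB (R : realType) (r : nat) (lambda : R[i]) (n : nat) (x : R[i])
    : R[i] :=
  limn (series (fun m : nat =>
    'C(m + r - 1, m)%:R * lambda ^+ m * Mtrans n x m : R[i]^o)).

Definition PhiE (R : realType) (r : nat) (lambda : R[i]) (n : nat) (x : R[i])
    : R[i] :=
  limn (series (fun m : nat =>
    (-1) ^+ m * 'C(m + r - 1, m)%:R * lambda ^+ m * Mtrans n x m : R[i]^o)).

(* (x +_M y)^n *)
Definition Madd_pow (K : fieldType) (x y : K) (n : nat) : K :=
  \sum_(k < n.+1) Mbinom K n k * x ^+ k * y ^+ (n - k).

(* The polynomial representing a polynomial function; it is unique because a  *)
(* numFieldType is infinite (see polyfunK).                                   *)
Definition polyfun (K : numFieldType) (f : K -> K) : {poly K} :=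
  xget 0 [set p : {poly K} | forall z, p.[z] = f z].

Lemma polyfunK (K : numFieldType) (p : {poly K}) : polyfun (horner p) = p.
Proof.
have inj (q : {poly K}) : (forall z, q.[z] = p.[z]) -> q = p.
  move=> qp; apply/eqP; rewrite -subr_eq0; apply/eqP.
  apply: (@roots_geq_poly_eq0 _ _ [seq (i%:R : K) | i <- iota 0 (size (q - p))]).
  - by apply/allP => z _; rewrite rootE hornerD hornerN qp subrr.
  - by rewrite map_inj_uniq ?iota_uniq // => i j /eqP; rewrite eqr_nat => /eqP.
  - by rewrite size_map size_iota.
rewrite /polyfun; case: xgetP => [q _ /inj // | noq].
by case: (noq p).
Qed.

(* f(x +_M y) for a polynomial function f *)
Definition Madd_eval (K : numFieldType) (f : K -> K) (x y : K) : K :=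
  \sum_(k < size (polyfun f)) (polyfun f)`_k * Madd_pow x y k.

(* Main.v *)
Require Import Defs.
From mathcomp Require Import all_boot all_order all_algebra.
From mathcomp Require Import all_classical all_reals.
From mathcomp Require Import topology normedtype sequences.
From mathcomp Require Import complex.
From mathcomp Require Import ring.

Import Order.TTheory GRing.Theory Num.Theory.
Import numFieldNormedType.Exports.

Local Open Scope classical_set_scope.
Local Open Scope ring_scope.
Local Open Scope complex_scope.

(** Summing the definition of P_{n,M}(x;m) against binom(m+r-1, m) lambda^m
    shows that Phi^{B,r}(-n, x) is n!_M times the coefficient of t^n in
    e_M^{xt} S(t), where S(t) = sum_m binom(m+r-1, m) lambda^m (e_M^t)^m does
    not involve x ([PhiBE]). So the values Phi^{B,r}(-n, x) form an Appell
    sequence for the M-exponential. For any such sequence, replacing x by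
    x +_M y multiplies the generating function by e_M^{yt}; as
    (e_M^{xt} e_M^{yt}) S = (e_M^{xt} S) e_M^{yt}, reading off the coefficient
    of t^n gives the addition formula ([Madd_eval_Appell]). The Euler case is
    the Bernoulli case at - lambda.

    The analytic content is the convergence of each coefficient of S(t), which
    lets the limit be exchanged with the finite sum over the powers of x. The
    coefficient of t^j in (e_M^t)^m and the number binom(m+r-1, m) are
    polynomial in m, in the sense that iterating the difference operator on
    them leads to 0 ([polyseq_fps_exp], [polyseq_bin]), and such sequences are
    closed under products ([polyseqM]). If f is one of them and (Df)(m) =
    f(m+1) - f(m), then the partial sums U_N of f(m) lambda^m and E_N of
    (Df)(m) lambda^m satisfy
      U_{N+1} = lambda U_N + f(0) + lambda E_N,
    so convergence of E forces convergence of U because |lambda| < 1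
    ([cvg_contracting]). By induction every series of f(m) lambda^m converges
    ([is_cvg_polyseq_series]); since the recurrence also names the limit, no
    appeal to completeness of the complex numbers is made. *)

(** * Products of formal series *)

Section FormalSeries.
Context {K : fieldType}.
Implicit Types a b c : fps K.

(** Products of coefficient sequences agree below order N with products of
    these polynomials, which transfers the ring laws of {poly K} to them. *)
Definition fps_trunc (N : nat) a : {poly K} := \poly_(i < N) a i.

Lemma fps_mul_trunc N a b n : (n < N)%N ->
  fps_mul a b n = (fps_trunc N a * fps_trunc N b)`_n.
Proof.
move=> nN; rewrite coefM; apply: eq_bigr => k _.
have kn : (k <= n)%N by rewrite -ltnS.
by rewrite !coef_poly (leq_ltn_trans kn nN) (leq_ltn_trans (leq_subr _ _) nN).
Qed.

Lemma fps_mulAC a b c n :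
  fps_mul (fps_mul a b) c n = fps_mul (fps_mul a c) b n.
Proof.
have E d e f : fps_mul (fps_mul d e) f n
             = (fps_trunc n.+1 d * fps_trunc n.+1 e * fps_trunc n.+1 f)`_n.
  rewrite coefM; apply: eq_bigr => k _.
  by rewrite (@fps_mul_trunc n.+1) // [in RHS]coef_poly ltnS leq_subr.
by rewrite !E mulrAC.
Qed.

End FormalSeries.

(** * M-binomial addition on Appell sequences *)

Lemma Mfact_gt0 n : (0 < Mfact n)%N.
Proof.
elim: n => [|n IH]; first by rewrite /Mfact big_geq.
rewrite /Mfact big_nat_recr //= muln_gt0 IH /=.
by rewrite /mersenne subn_gt0 -(expn0 2) ltn_exp2l.
Qed.

Section Umbral.
Context {K : numFieldType}.
Implicit Types (x y : K) (S : fps K).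

Lemma Mfact_neq0 n : (Mfact n)%:R != 0 :> K.
Proof. by rewrite pnatr_eq0 -lt0n Mfact_gt0. Qed.

(** The coefficientwise form of e_M^{(x +_M y)t} = e_M^{xt} e_M^{yt}. *)
Lemma Madd_powE x y n :
  Madd_pow x y n = (Mfact n)%:R * fps_mul (Mexp x) (Mexp y) n.
Proof.
rewrite /Madd_pow /fps_mul mulr_sumr; apply: eq_bigr => k _.
rewrite /Mbinom /Mexp; field; by rewrite !Mfact_neq0.
Qed.

(** Any coefficient list of the right length may be used to evaluate at
    x +_M y: the polynomial recovered from the function is the same, up to
    zero leading coefficients. *)
Lemma Madd_evalE (N : nat) (a : nat -> K) x y :
  Madd_eval (fun z => \sum_(k < N) a k * z ^+ k) x y
  = \sum_(k < N) a k * Madd_pow x y k.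
Proof.
pose p : {poly K} := \poly_(k < N) a k.
rewrite /Madd_eval (_ : (fun z => _) = horner p); last first.
  by apply/funext => z; rewrite horner_poly.
rewrite polyfunK (big_ord_widen N (fun k => p`_k * Madd_pow x y k)) ?size_poly //.
rewrite big_mkcond /=; apply: eq_bigr => k _; rewrite [in LHS]coef_poly ltn_ord.
case: ltnP => // sk; have := nth_default 0 sk.
by rewrite coef_poly ltn_ord => ->; rewrite mul0r.
Qed.

(** Both sides are n!_M times the coefficient of t^n in
    e_M^{xt} e_M^{yt} S(t): on the left the two exponentials are multiplied
    first, on the right e_M^{xt} is first multiplied by S(t). *)
Lemma Madd_eval_Appell S n x y :
  Madd_eval (fun z => (Mfact n)%:R * fps_mul (Mexp z) S n) x y
  = \sum_(k < n.+1) Mbinom K n k * ((Mfact k)%:R * fps_mul (Mexp x) S k)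
      * y ^+ (n - k).
Proof.
pose a k := (Mfact n)%:R / (Mfact k)%:R * S (n - k)%N.
rewrite (_ : (fun z => _) = fun z => \sum_(k < n.+1) a k * z ^+ k); last first.
  apply/funext => z; rewrite /fps_mul mulr_sumr; apply: eq_bigr => k _.
  by rewrite /a /Mexp; ring.
rewrite Madd_evalE.
transitivity ((Mfact n)%:R * fps_mul (fps_mul (Mexp x) (Mexp y)) S n).
  under eq_bigr do rewrite Madd_powE.
  set E := fps_mul _ _; rewrite /fps_mul mulr_sumr; apply: eq_bigr => k _.
  by rewrite /a; field; rewrite Mfact_neq0.
rewrite fps_mulAC; set P := fps_mul _ S.
rewrite /fps_mul mulr_sumr; apply: eq_bigr => k _.
by rewrite /Mbinom /Mexp; field; rewrite !Mfact_neq0.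
Qed.

End Umbral.

(** * Sequences depending polynomially on the index *)

Section PolynomialSequences.
Context {K : fieldType}.
Implicit Types f g : nat -> K.

Definition fdiff f : nat -> K := fun m => f m.+1 - f m.

(** In characteristic 0 these are the sequences of values p(0), p(1), ... of
    polynomials p. Generating the class by differences gives induction on the
    degree without exhibiting p. *)
Inductive polyseq : (nat -> K) -> Prop :=
| polyseq0 : polyseq (fun=> 0)
| polyseq_diff f : polyseq (fdiff f) -> polyseq f.

Lemma fdiff0 : fdiff (fun=> 0) = fun=> 0.
Proof. by apply/funext => m; rewrite /fdiff subrr. Qed.

Lemma polyseq_fdiff f : polyseq f -> polyseq (fdiff f).
Proof. by case=> [|//]; rewrite fdiff0; exact: polyseq0. Qed.

Lemma polyseq_cst c : polyseq (fun=> c).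
Proof.
apply: polyseq_diff; rewrite (_ : fdiff _ = fun=> 0); first exact: polyseq0.
by apply/funext => m; rewrite /fdiff subrr.
Qed.

Lemma polyseqD f g : polyseq f -> polyseq g -> polyseq (fun m => f m + g m).
Proof.
move=> pf; elim: pf g => {f} [|f _ IH] g pg.
  by rewrite (_ : (fun m => _) = g) //; apply/funext => m; rewrite add0r.
apply: polyseq_diff.
rewrite (_ : fdiff _ = fun m => fdiff f m + fdiff g m).
  exact/IH/polyseq_fdiff.
by apply/funext => m; rewrite /fdiff; ring.
Qed.

(** Leibniz rule D(fg) = f Dg + (Df) g + (Df)(Dg): in each term one of the
    factors has lower degree, hence the nested induction on f and on g. *)
Lemma polyseqM f g : polyseq f -> polyseq g -> polyseq (fun m => f m * g m).
Proof.
move=> pf; elim: pf g => {f} [|f _ IHf] g pg.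
  by rewrite (_ : (fun m => _) = fun=> 0); [exact: polyseq0|];
     apply/funext => m; rewrite mul0r.
elim: pg => {g} [|g pg IHg].
  by rewrite (_ : (fun m => _) = fun=> 0); [exact: polyseq0|];
     apply/funext => m; rewrite mulr0.
apply: polyseq_diff.
rewrite (_ : fdiff _ = fun m =>
  f m * fdiff g m + fdiff f m * g m + fdiff f m * fdiff g m).
  by do 2?apply: polyseqD; [exact: IHg|apply/IHf/polyseq_diff|exact: IHf].
by apply/funext => m; rewrite /fdiff; ring.
Qed.

Lemma polyseq_sum n (F : nat -> nat -> K) :
  (forall k, (k < n)%N -> polyseq (F k)) ->
  polyseq (fun m => \sum_(k < n) F k m).
Proof.
elim: n => [|n IH] pF.
  rewrite (_ : (fun m => _) = fun=> 0); first exact: polyseq0.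
  by apply/funext => m; rewrite big_ord0.
rewrite (_ : (fun m => _) = fun m => \sum_(k < n) F k m + F n m).
  by apply: polyseqD; [apply: IH => k kn; apply/pF/ltnW|exact: pF].
by apply/funext => m; rewrite big_ord_recr.
Qed.

(** By Pascal's rule the difference of m |-> binom(m+s+1, m) is the shift of
    m |-> binom(m+s, m), and a shift f(m+1) is f(m) + (Df)(m). *)
Lemma polyseq_bin s : polyseq (fun m => 'C(m + s, m)%:R).
Proof.
elim: s => [|s IH].
  rewrite (_ : (fun m => _) = fun=> 1); first exact: polyseq_cst.
  by apply/funext => m; rewrite addn0 binn.
apply: polyseq_diff; set f := (fun m => _) in IH.
rewrite (_ : fdiff _ = fun m => f m + fdiff f m).
  exact/polyseqD/polyseq_fdiff.
apply/funext => m; rewrite /fdiff /f addSn !addnS binS -addSn natrD.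
ring.
Qed.

(** The difference in m is the coefficient of t^j in a^m (a - 1). Since a - 1
    starts at order 1, only coefficients of a^m of order below j occur in it,
    so strong induction on j applies. *)
Lemma polyseq_fps_exp (a : fps K) j : a 0%N = 1 ->
  polyseq (fun m => fps_exp a m j).
Proof.
move=> a0; elim/ltn_ind: j => j IH.
apply: polyseq_diff.
rewrite (_ : fdiff _ =
  fun m => \sum_(k < j) a k.+1 * fps_exp a m (j - k.+1)%N).
  apply: (@polyseq_sum j (fun k m => a k.+1 * fps_exp a m (j - k.+1)%N)).
  move=> k kj; apply: polyseqM; first exact: polyseq_cst.
  by apply: IH; rewrite ltn_subrL (leq_ltn_trans _ kj).
apply/funext => m.
have expS : fps_exp a m.+1 j = \sum_(k < j.+1) a k * fps_exp a m (j - k)%N by [].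
by rewrite /fdiff expS big_ord_recl a0 mul1r subn0 addrC addKr.
Qed.

End PolynomialSequences.

(** * Convergence of power-weighted series *)

Section PowerWeightedSeries.
Context {K : numFieldType} (lambda : K) (lambda_lt1 : `|lambda| < 1)
        (expr_lambda : (fun n => lambda ^+ n : K^o) @ \oo --> (0 : K^o)).

(** Past an index N where e is at most (eps/2)(1 - |lambda|), the bound
    |w_{N+k}| <= eps/2 + |lambda|^k |w_N| is preserved by the recurrence,
    because eps/2 is the fixed point of t |-> |lambda| t +
    (eps/2)(1 - |lambda|). *)
Lemma cvg_contracting0 (w e : nat -> K^o) :
  (forall n, w n.+1 = lambda * w n + e n) ->
  e @ \oo --> (0 : K^o) -> w @ \oo --> (0 : K^o).
Proof.
move=> we e0; apply/cvgr0Pnorm_lt => eps eps0.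
have l1 : 0 < 1 - `|lambda| by rewrite subr_gt0.
have d0 : 0 < eps / 2 * (1 - `|lambda|) by rewrite mulr_gt0 ?divr_gt0.
have [N _ eN] := (cvgr0Pnorm_lt _).1 e0 _ d0.
have wN k : `|w (N + k)%N| <= eps / 2 + `|lambda ^+ k * w N|.
  elim: k => [|k IH]; first by rewrite addn0 mul1r lerDr ltW ?divr_gt0.
  rewrite addnS we (le_trans (ler_normD _ _)) // normrM.
  have /ltW ek : `|e (N + k)%N| < _ := eN (N + k)%N (leq_addr _ _).
  rewrite (le_trans (lerD (ler_wpM2l (normr_ge0 _) IH) ek)) //.
  rewrite exprS -[lambda * lambda ^+ k * w N]mulrA (normrM lambda).
  set t := `|lambda ^+ k * w N|.
  by rewrite le_eqVlt; apply/orP; left; apply/eqP; field.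
have : (fun k => lambda ^+ k * w N : K^o) @ \oo --> (0 : K^o).
  by rewrite -(mul0r (w N)); apply: cvgMr_tmp.
have h0 : 0 < eps / 2 by rewrite divr_gt0.
move=> /cvgr0Pnorm_lt /(_ _ h0) [M _ hM].
exists (N + M)%N => // n /= NMn.
have -> : n = (N + (n - N))%N by rewrite subnKC // (leq_trans (leq_addr _ _) NMn).
apply: (le_lt_trans (wN _)); rewrite [ltRHS](splitr eps) ltrD2l.
by apply: hM => /=; rewrite leq_subRL // (leq_trans (leq_addr _ _) NMn).
Qed.

Lemma cvg_contracting (w b : nat -> K^o) (l : K) :
  (forall n, w n.+1 = lambda * w n + b n) ->
  b @ \oo --> (l : K^o) -> w @ \oo --> (l / (1 - lambda) : K^o).
Proof.
move=> wb bl; have l1 : 1 - lambda != 0.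
  by apply: contraTneq lambda_lt1 => /subr0_eq <-; rewrite normr1 ltxx.
apply/subr_cvg0; apply: (@cvg_contracting0 _ (fun n => b n - l)).
  by move=> n; rewrite wb; field.
exact/subr_cvg0.
Qed.

(** Induction on the degree of f through the recurrence
    U_{N+1} = lambda U_N + f(0) + lambda E_N, where E is the same series for
    the difference of f. *)
Lemma is_cvg_polyseq_series (f : nat -> K) : polyseq f ->
  cvgn (series (fun m => f m * lambda ^+ m : K^o)).
Proof.
elim=> {f} [|f _ /cvg_ex [l dl]].
  rewrite (_ : series _ = cst 0); first exact: is_cvg_cst.
  by apply/funext => N; rewrite /series /= big1 // => k _; rewrite mul0r.
apply/cvg_ex; eexists.
pose E := series (fun m => fdiff f m * lambda ^+ m : K^o).
apply: (@cvg_contracting _ (fun N => f 0%N + lambda * E N : K^o)); last first.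
  by apply: cvgD; [exact: cvg_cst|exact: cvgMl_tmp dl].
move=> N; rewrite /E /series /= big_nat_recl // expr0 mulr1 addrCA; congr +%R.
rewrite -mulrDr -big_split mulr_sumr; apply: eq_bigr => k _ /=.
by rewrite /fdiff exprS; ring.
Qed.

End PowerWeightedSeries.

(** The real geometric sequence of ratio |lambda| carries over, since a
    positive complex number is a positive real. *)
Lemma complex_cvg_expr (R : realType) (lambda : R[i]) : `|lambda| < 1 ->
  (fun n => lambda ^+ n : R[i]^o) @ \oo --> (0 : R[i]^o).
Proof.
move=> l1; apply/cvgr0Pnorm_lt => eps.
rewrite normc_def in l1; set q := Num.sqrt _ in l1.
have normq : `|lambda| = q%:C by rewrite normc_def.
have q1 : `|q| < 1 by rewrite ger0_norm ?sqrtr_ge0 // -ltcR.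
case: eps => e i; rewrite ltcE /= => /andP[/eqP -> e0].
have /cvgr0Pnorm_lt /(_ _ e0) := cvg_expr q1.
apply: filterS => n; rewrite ger0_norm ?exprn_ge0 ?sqrtr_ge0 // => qn.
have -> : `|(lambda ^+ n : R[i]^o)| = (q ^+ n)%:C.
  by rewrite (rmorphXn (real_complex R)) /= -normq; exact: normrX.
by rewrite -[X in _ < X]/(e%:C) ltcR.
Qed.

(** * Generating function of the interpolation values *)

Section Interpolation.
Context {R : realType}.

(** The coefficients of S(t) = sum_m binom(m+r-1, m) lambda^m (e_M^t)^m, which
    is (1 - lambda e_M^t)^(-r). *)
Definition PhiB_coef (r : nat) (lambda : R[i]) : fps R[i] := fun j =>
  limn (series (fun m =>
    'C(m + r - 1, m)%:R * lambda ^+ m * fps_exp (Mexp 1) m j : R[i]^o)).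

Lemma PhiB_coef_is_cvg r (lambda : R[i]) j : (0 < r)%N -> `|lambda| < 1 ->
  cvgn (series (fun m =>
    'C(m + r - 1, m)%:R * lambda ^+ m * fps_exp (Mexp 1) m j : R[i]^o)).
Proof.
case: r => // s _ l1.
rewrite (_ : (fun m => _) = fun m =>
  'C(m + s, m)%:R * fps_exp (Mexp 1) m j * lambda ^+ m).
  apply: is_cvg_polyseq_series => //; first exact: complex_cvg_expr.
  apply: polyseqM; first exact: polyseq_bin.
  by apply: polyseq_fps_exp; rewrite /Mexp /Mfact big_geq // divr1.
by apply/funext => m; rewrite addnS subn1 mulrAC.
Qed.

(** Only finitely many powers of x enter P_{n,M}(x;m), so the sum over m can be
    taken coefficient by coefficient in x; each of these series converges. *)
Lemma PhiBE r (lambda : R[i]) n x : (0 < r)%N -> `|lambda| < 1 ->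
  PhiB r lambda n x
  = (Mfact n)%:R * fps_mul (Mexp x) (PhiB_coef r lambda) n.
Proof.
move=> r0 l1; rewrite /PhiB /fps_mul mulr_sumr.
apply: (@cvg_lim R[i]^o) => //.
pose u k m : R[i]^o :=
  'C(m + r - 1, m)%:R * lambda ^+ m * fps_exp (Mexp 1) m (n - k)%N.
rewrite (_ : series _ = fun N =>
  \sum_(k < n.+1) (Mfact n)%:R * (Mexp x k * series (u k) N)); last first.
  apply/funext => N; rewrite /series /=.
  under [RHS]eq_bigr do rewrite mulr_sumr mulr_sumr.
  rewrite exchange_big; apply: eq_bigr => m _.
  rewrite /Mtrans /fps_mul mulr_sumr mulr_sumr; apply: eq_bigr => k _.
  by rewrite /u; ring.
apply: cvg_big => [|k _]; first exact: add_continuous; do 2!apply: cvgMl_tmp.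
exact: PhiB_coef_is_cvg.
Qed.

Lemma PhiE_PhiB r (lambda : R[i]) n x : PhiE r lambda n x = PhiB r (- lambda) n x.
Proof.
rewrite /PhiE; under eq_fun => m do
  rewrite [_ * 'C(_, _)%:R]mulrC -[_ * lambda ^+ m]mulrA -exprMn mulN1r.
by [].
Qed.

Lemma PhiB_Madd r (lambda : R[i]) n x y : (0 < r)%N -> `|lambda| < 1 ->
  Madd_eval (PhiB r lambda n) x y
  = \sum_(k < n.+1) Mbinom R[i] n k * PhiB r lambda k x * y ^+ (n - k).
Proof.
move=> r0 l1.
rewrite (_ : PhiB r lambda n =
  fun z => (Mfact n)%:R * fps_mul (Mexp z) (PhiB_coef r lambda) n).
  by rewrite Madd_eval_Appell; apply: eq_bigr => k _; rewrite PhiBE.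
by apply/funext => z; rewrite PhiBE.
Qed.

End Interpolation.

Theorem theorem7p3 (R : realType) (r n : nat) (x y lambda : R[i])
    (r_gt0 : (0 < r)%N) (lambda_lt1 : `|lambda| < 1) :
  Madd_eval (PhiB r lambda n) x y =
    \sum_(k < n.+1) Mbinom R[i] n k * PhiB r lambda k x * y ^+ (n - k)
  /\
  Madd_eval (PhiE r lambda n) x y =
    \sum_(k < n.+1) Mbinom R[i] n k * PhiE r lambda k x * y ^+ (n - k).
Proof.
split; first exact: PhiB_Madd.
rewrite (_ : PhiE r lambda n = PhiB r (- lambda) n).
  rewrite PhiB_Madd ?normrN //; apply: eq_bigr => k _; by rewrite PhiE_PhiB.
by apply/funext => z; exact: PhiE_PhiB.
Qed.
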